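(* Let $M$ be a compact finite-dimensional manifold and $f\colon M\to M$ a continuous map. If the set $\mathcal{O}$ of all observable measures for $f$ is countably infinite, then there exist countably infinitely many SRB measures for $f$ such that the union of their basins of attraction covers $M$ up to a set of zero Lebesgue measure. In this case $\mathcal{O}$ is the weak$^*$-closure of the set of all SRB measures for $f$.
   Context: Let $m$ be a Lebesgue measure on $M$, normalized so that $m(M)=1$; $m$ is not assumed to be $f$-invariant. Let $\mathcal{P}$ be the set of all Borel probability measures on $M$, endowed with the weak$^*$ topology, and fix a metric $\mathrm{dist}$ on $\mathcal{P}$ inducing this topology. For $x\in M$, let $p\omega(x)\subset\mathcal{P}$ be the set of all weak$^*$ limits of convergent subsequences of the sequence $\left\{\frac1n\sum_{j=0}^{n-1}\delta_{f^j(x)}\right\}_{n\ge 1}$, where $\delta_y$ is the Dirac probability measure supported at $y$. For $\mu\in\mathcal{P}$, $\mathrm{dist}(p\omega(x),\mu)$ denotes the distance from the point $\mu$ to the set $p\omega(x)$. A measure $\mu\in\mathcal{P}$ is called SRB (or physical) for $f$ if the set $A(\mu)=\{x\in M:\ p\omega(x)=\{\mu\}\}$ has positive Lebesgue measure $m$; the set $A(\mu)$ is called the basin of attraction of $\mu$. A measure $\mu\in\mathcal{P}$ is called observable (or SRB-like) for $f$ if for every $\varepsilon>0$ the set $A_\varepsilon(\mu)=\{x\in M:\ \mathrm{dist}(p\omega(x),\mu)<\varepsilon\}$ has positive Lebesgue measure $m$. The set of all observable measures for $f$ is denoted $\mathcal{O}$. *)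

(* Defs.v *)
From HB Require Import structures.
From mathcomp Require Import all_boot all_order all_algebra.
From mathcomp Require Import all_classical all_reals all_analysis.

Set Implicit Arguments.
Unset Strict Implicit.
Unset Printing Implicit Defensive.

Import Order.TTheory GRing.Theory Num.Theory.
Import numFieldNormedType.Exports.

Local Open Scope classical_set_scope.
Local Open Scope ring_scope.

Notation borel M := (g_sigma_algebraType (@open M)).

Section LebesgueMeasureRn.
Context (R : realType).
Local Notation mR := (measurableTypeR R).

Definition tuple_cons (n : nat) (p : mR * n.-tuple mR) : n.+1.-tuple mR :=
  [tuple of p.1 :: p.2].

Lemma measurable_tuple_cons (n : nat) : measurable_fun setT (@tuple_cons n).
Proof.
by apply: measurable_cons;
  [exact: measurable_fst|exact: measurable_snd].
Qed.

Section Step.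
Context (n : nat).
Variable mu : {sigma_finite_measure set (n.-tuple mR) -> \bar R}.

Definition lebesgue_cons : set (n.+1.-tuple mR) -> \bar R :=
  pushforward (lebesgue_measure \x mu)%E (@tuple_cons n).

Let lebesgue_cons0 : lebesgue_cons set0 = 0%E.
Proof. by rewrite /lebesgue_cons /pushforward preimage_set0 measure0. Qed.

Let lebesgue_cons_ge0 A : (0 <= lebesgue_cons A)%E.
Proof. by rewrite /lebesgue_cons /pushforward measure_ge0. Qed.

Let lebesgue_cons_sigma_additive : semi_sigma_additive lebesgue_cons.
Proof.
move=> F mF tF mUF; rewrite /lebesgue_cons /pushforward preimage_bigcup.
have mpre A : measurable A -> measurable (@tuple_cons n @^-1` A).
  by move=> mA; rewrite -[X in measurable X]setTI; exact: measurable_tuple_cons.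
apply: measure_semi_sigma_additive => //.
- by move=> k; exact: mpre.
- move/trivIsetP : tF => tF; apply/trivIsetP => i j _ _ ij.
  by rewrite -preimage_setI tF// preimage_set0.
- by rewrite -preimage_bigcup; exact: mpre.
Qed.

HB.instance Definition _ := isMeasure.Build _ _ _ lebesgue_cons
  lebesgue_cons0 lebesgue_cons_ge0 lebesgue_cons_sigma_additive.

Let lebesgue_cons_sigma_finite : sigma_finite setT lebesgue_cons.
Proof.
have /sigma_finiteP[F [TF ndF Foo]] := sigma_finiteT (@lebesgue_measure R).
have /sigma_finiteP[G [TG ndG Goo]] := sigma_finiteT mu.
pose g (t : n.+1.-tuple mR) : mR * n.-tuple mR :=
  (tnth t ord0, [tuple of behead t]).
have gK : cancel (@tuple_cons n) g.
  by move=> [x t]; rewrite /g /tuple_cons /=; congr pair; apply/val_inj.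
have mg : measurable_fun setT g.
  apply/measurable_fun_pairP; split.
    exact: (measurable_tnth ord0).
  exact: measurable_behead.
exists (fun i => g @^-1` (F i `*` G i)).
  apply/seteqP; split => // t _.
  have [i _ Fi] : (\bigcup_i F i) (g t).1 by rewrite -TF.
  have [j _ Gj] : (\bigcup_i G i) (g t).2 by rewrite -TG.
  exists (maxn i j) => //; split.
    by move: Fi; exact/subsetPset/ndF/leq_maxl.
  by move: Gj; exact/subsetPset/ndG/leq_maxr.
move=> i; have [mFi Fi] := Foo i; have [mGi Gi] := Goo i; split.
  by rewrite -[X in measurable X]setTI; apply: mg => //; exact: measurableX.
rewrite /lebesgue_cons /pushforward -comp_preimage.
rewrite (_ : g \o _ = id) ?preimage_id; last by apply/funext => p; exact: gK.
by rewrite product_measure1E// lte_mul_pinfty// ge0_fin_numE.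
Qed.

HB.instance Definition _ := Measure_isSigmaFinite.Build _ _ _ lebesgue_cons
  lebesgue_cons_sigma_finite.

End Step.

(* The product of [n] copies of the Lebesgue measure of R. *)
Fixpoint lebesgue_Rn (n : nat) :
    {sigma_finite_measure set (n.-tuple mR) -> \bar R} :=
  match n with
  | 0 => dirac [tuple]
  | k.+1 => lebesgue_cons (lebesgue_Rn k)
  end.

Definition row_of_tuple (n : nat) (t : n.-tuple mR) : 'rV[R]_n :=
  \row_i tnth t i.

End LebesgueMeasureRn.

Section Manifold.
Context (R : realType) (n : nat) (M : ptopologicalType).

(* Only the values of [chart_fun] on [chart_dom] and of [chart_inv] on
   [chart_cod] are meaningful. *)
Record chart := Chart {
  chart_dom : set M ;
  chart_fun : M -> 'rV[R]_n ;
  chart_inv : 'rV[R]_n -> M }.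

Definition chart_cod (c : chart) : set 'rV[R]_n := chart_fun c @` chart_dom c.

Definition is_chart (c : chart) : Prop :=
  [/\ open (chart_dom c), open (chart_cod c),
      {in chart_dom c, cancel (chart_fun c) (chart_inv c)},
      {within chart_dom c, continuous (chart_fun c)} &
      {within chart_cod c, continuous (chart_inv c)}].

Definition C1_on (D : set 'rV[R]_n) (g : 'rV[R]_n -> 'rV[R]_n) : Prop :=
  forall x, D x -> differentiable g x /\ {for x, continuous (jacobian g)}.

Definition C1_compatible (c d : chart) : Prop :=
  C1_on (chart_fun c @` (chart_dom c `&` chart_dom d))
        (chart_fun d \o chart_inv c).

Definition is_C1_atlas (atlas : set chart) : Prop :=
  [/\ forall c, atlas c -> is_chart c,
      forall x, exists2 c, atlas c & chart_dom c x &
      forall c d, atlas c -> atlas d -> C1_compatible c d].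

(* A C^1 manifold of dimension [n] without boundary; [n = 0] is allowed. *)
Definition is_manifold (atlas : set chart) : Prop :=
  [/\ hausdorff_space M, @second_countable M & is_C1_atlas atlas].

(* In every chart, [m] has a positive continuous density with respect to the
   Lebesgue measure of R^n; the volume of a Riemannian metric is an example. *)
Definition is_Lebesgue_on (atlas : set chart) (m : set (borel M) -> \bar R) :
    Prop :=
  forall c, atlas c -> exists rho : 'rV[R]_n -> R,
    [/\ {within chart_cod c, continuous rho},
        forall y, chart_cod c y -> 0 < rho y &
        forall A : set (borel M), measurable A -> A `<=` chart_dom c ->
          m A = (\int[lebesgue_Rn R n]_(t in
                   [set t | (chart_fun c @` A) (row_of_tuple t)])
                 (rho (row_of_tuple t))%:E)%E].

End Manifold.

Section BorelProbability.
Context (R : realType) (M : ptopologicalType).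

(* An inhabitant of [probability (borel M) R] is a function on all subsets of
   [M], with unconstrained values on the non-Borel ones.  Requiring it to vanish
   there makes each Borel probability measure be represented exactly once, so
   that equality and cardinality have their usual meaning. *)
Record borel_prob := BorelProb {
  borel_prob_val :> probability (borel M) R ;
  borel_prob_out : forall A, ~ measurable A -> borel_prob_val A = 0%E }.

HB.instance Definition _ := gen_eqMixin borel_prob.
HB.instance Definition _ := gen_choiceMixin borel_prob.

Definition integral_against (mu : borel_prob) : {ptws continuousType M R -> R} :=
  fun g => \int[mu]_x g x.

(* The weak* topology. *)
HB.instance Definition _ :=
  Topological.copy borel_prob (initial_topology integral_against).

Section Trim.
Variable mu : probability (borel M) R.

Definition trim (A : set (borel M)) : \bar R :=
  if `[< measurable A >] then mu A else 0%E.

Let trimE A : measurable A -> trim A = mu A.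
Proof. by rewrite /trim => mA; rewrite asboolT. Qed.

Let trim0 : trim set0 = 0%E.
Proof. by rewrite trimE. Qed.

Let trim_ge0 A : (0 <= trim A)%E.
Proof. by rewrite /trim; case: ifP. Qed.

Let trim_sigma_additive : semi_sigma_additive trim.
Proof.
move=> F mF tF mUF; rewrite trimE//.
rewrite [X in X @ _ --> _](_ : _ = fun n => (\sum_(0 <= i < n) mu (F i))%E).
  exact: measure_semi_sigma_additive.
by apply/funext => n; apply: eq_bigr => i _; rewrite trimE.
Qed.

HB.instance Definition _ := isMeasure.Build _ _ _ trim
  trim0 trim_ge0 trim_sigma_additive.

Let trim_setT : trim setT = 1%E.
Proof. by rewrite trimE// probability_setT. Qed.

HB.instance Definition _ := Measure_isProbability.Build _ _ _ trim trim_setT.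

Lemma trim_out A : ~ measurable A -> trim A = 0%E.
Proof. by rewrite /trim => mA; rewrite asboolF. Qed.

Definition borel_prob_of : borel_prob := BorelProb trim_out.

End Trim.

Section Empirical.
Variables (f : M -> M) (n : nat) (x : M).

Definition orbit_average : set (borel M) -> \bar R :=
  mscale (n.+1%:R^-1)%:nng
    (msum (fun j => \d_(iter j f x : borel M)) n.+1).

HB.instance Definition _ := Measure.on orbit_average.

Let orbit_average_setT : orbit_average setT = 1%E.
Proof.
rewrite /orbit_average /mscale /= /msum (eq_bigr (fun=> 1%E)); last first.
  by move=> i _ /=; rewrite diracT.
by rewrite sumEFin big_const_ord iter_addr addr0 -EFinM mulVf.
Qed.

HB.instance Definition _ :=
  Measure_isProbability.Build _ _ _ orbit_average orbit_average_setT.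

(* The term of index [n + 1] of the sequence of empirical measures. *)
Definition empirical : borel_prob := borel_prob_of orbit_average.

End Empirical.

Definition p_omega (f : M -> M) (x : M) : set borel_prob :=
  [set mu | exists2 k : nat -> nat, {homo k : i j / (i < j)%N} &
     (fun i => empirical f (k i) x) @ \oo --> mu].

Definition is_metric (T : Type) (dist : T -> T -> R) : Prop :=
  [/\ forall x y, dist x y = 0 <-> x = y,
      forall x y, dist x y = dist y x &
      forall x y z, dist x z <= dist x y + dist y z].

Definition metrizes_weakstar (dist : borel_prob -> borel_prob -> R) : Prop :=
  is_metric dist /\
  forall U : set borel_prob, open U <->
    (forall mu, U mu -> exists2 e, 0 < e & [set nu | dist mu nu < e] `<=` U).

(* With the convention that the distance to the empty set is infinite. *)
Definition dist_to_set (dist : borel_prob -> borel_prob -> R)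
    (K : set borel_prob) (mu : borel_prob) : \bar R :=
  ereal_inf [set (dist nu mu)%:E | nu in K].

Definition basin (f : M -> M) (mu : borel_prob) : set M :=
  [set x | p_omega f x = [set mu]].

Definition SRB (m : borel_prob) (f : M -> M) : set borel_prob :=
  [set mu | (0 < m (basin f mu))%E].

Definition eps_basin (dist : borel_prob -> borel_prob -> R) (f : M -> M)
    (mu : borel_prob) (e : R) : set M :=
  [set x | (dist_to_set dist (p_omega f x) mu < e%:E)%E].

Definition observable (m : borel_prob)
    (dist : borel_prob -> borel_prob -> R) (f : M -> M) : set borel_prob :=
  [set mu | forall e, 0 < e -> (0 < m (eps_basin dist f mu e))%E].

End BorelProbability.

(* Main.v *)
From HB Require Import structures.
Require Import Defs.
From mathcomp Require Import all_boot all_order all_algebra.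
From mathcomp Require Import all_classical all_reals all_analysis.
From mathcomp Require Import measurable_realfun zify ring lra.
Import Order.TTheory GRing.Theory Num.Theory.
Import numFieldNormedType.Exports.

(** The engine is the compactness of the space P of Borel probability measures
    on a compact, Hausdorff, second countable space M ([borel_prob_compact]).

    Compactness of P.  Countably many pairs of disjoint open sets (U_k, V_k)
    separate the points of M, and y |-> (y in U_k)_k is a Borel binary coding
    of M.  The measures of the cells of this coding converge along any
    ultrafilter on P, to numbers p(w), indexed by binary words, that split
    additively along the binary tree.  Cutting [0, 1[ into nested intervals of
    lengths p(w) makes every real number of [0, 1[ follow an infinite branch of
    the tree, and the closed sets attached to the nodes of that branch shrink to
    a single point of M ([random_point]).  The distribution of this random
    point under the Lebesgue measure is the weak* limit of the ultrafilter: a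
    continuous function on M is uniformly close to a constant on each cell of
    high depth ([hull_oscillation]), so its integrals are uniformly approximated
    by finite sums over the cells ([tree_sum_integral]).

    Dynamics.  Compactness turns the definitions of A_e(mu) and of the basins
    into countable combinations of the open sets
    {x | dist mu (sigma_n x) < r}, where sigma_n x is the n-th empirical measure
    of x, so all these sets are Borel.  Each mu outside the set O of observable
    measures has a neighbourhood that p_omega x meets only for x in a null set,
    and O is closed; covering the complement of O by countably many compact sets
    gives p_omega x `<=` O for almost every x ([p_omega_ae_observable]).

    Consecutive empirical measures become weak*-close.  If p_omega x had two
    points mu and nu, the distance to mu along the sequence sigma_n x would
    therefore cross each level of ]0, dist mu nu[ infinitely often, and each
    level would be attained on p_omega x ([p_omega_crossing]); so p_omega x
    would be uncountable.  As O is countable, p_omega x is a single point of O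
    for almost every x.

    Hence the basins of the elements of O cover M up to a null set, and since O
    is countable those of zero measure may be discarded: the SRB measures have
    the required covering property.  They are dense in O, because a set
    A_e(mu) of positive measure meets a basin of positive measure; and they are
    infinitely many, because a finite set is closed and would equal O. *)

Set Implicit Arguments.
Unset Strict Implicit.
Unset Printing Implicit Defensive.

Local Open Scope classical_set_scope.
Local Open Scope ring_scope.

(** * Weak* convergence, and bounded continuous functions *)

(** The weak* topology is the initial topology of the product topology, where
    convergence is coordinatewise. *)
Lemma weakstar_cvgP (R : realType) (M : ptopologicalType)
    (F : set_system (borel_prob R M)) (mu : borel_prob R M) : Filter F ->
  F --> mu <-> forall g : continuousType M R,
    (fun nu : borel_prob R M => \int[nu]_x g x) @ F --> \int[mu]_x g x.
Proof.
move=> FF; split=> [Fmu g|Fg].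
  have c : continuous (fun nu : borel_prob R M => \int[nu]_x g x).
    move=> nu; apply: (@continuous_comp _ _ _ (@integral_against R M)
       (fun h : {ptws continuousType M R -> R} => h g)).
      exact: initial_continuous.
    exact: proj_continuous.
  by apply: cvg_trans (c mu); exact: cvg_app.
have FP : @integral_against R M @ F --> integral_against mu.
  apply/cvg_sup => g; apply/cvg_image.
    by rewrite eqEsubset; split=> // v _; exists (cst v).
  move=> A /Fg; rewrite /= nbhs_simpl => FA.
  exists ((fun h : {ptws continuousType M R -> R} => h g) @^-1` A) => //.
  by rewrite image_preimage // eqEsubset; split => // v _; exists (cst v).
move=> A [_ [[B Bop <-] Bmu BA]].
apply: filterS BA _; apply: FP; exact: open_nbhs_nbhs.
Qed.

Lemma continuous_borel_measurable (R : realType) (M : ptopologicalType)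
    (g : M -> R) :
  continuous g -> measurable_fun setT (g : borel M -> R).
Proof.
move=> cg; apply: (measurability _ (RGenOpens.measurableE R)).
move=> _ [_ [a [b ->] <-]]; rewrite setTI; apply: sub_sigma_algebra.
by apply: (open_comp (fun y _ => cg y)); exact: interval_open.
Qed.

Lemma continuous_compact_norm_le (R : realType) (M : ptopologicalType)
    (g : M -> R) : compact [set: M] -> continuous g ->
  exists D : R, forall y, `|g y| <= D.
Proof.
move=> cM cg; have : compact (g @` setT).
  by apply: continuous_compact => //; exact: continuous_subspaceT.
move=> /compact_bounded[r [_ h]]; exists (`|r| + 1) => y.
by apply: (h (`|r| + 1)); [rewrite ltr_pwDr// ler_norm|exists y].
Qed.

Lemma norm_le_bounded (R : realType) (T : Type) (g : T -> R) (D : R) :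
  (forall y, `|g y| <= D) -> [bounded g y | y in [set: T]].
Proof.
move=> gD; exists D; split; first exact: num_real.
by move=> r Dr y _; exact: le_trans (gD y) (ltW Dr).
Qed.

Lemma continuous_integrable (R : realType) (M : ptopologicalType)
    (nu : {finite_measure set (borel M) -> \bar R}) (g : M -> R) :
  compact [set: M] -> continuous g ->
  nu.-integrable setT (EFin \o (g : borel M -> R)).
Proof.
move=> cM cg; apply: measurable_bounded_integrable => //.
- by rewrite -ge0_fin_numE// fin_num_measure.
- exact: continuous_borel_measurable.
- by have [D /norm_le_bounded] := continuous_compact_norm_le cM cg.
Qed.

Lemma Rintegral_borel_prob_of (R : realType) (M : ptopologicalType)
    (P : probability (borel M) R) (g : M -> R) :
  \int[borel_prob_of P]_x g x = \int[P]_x g x.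
Proof.
congr fine; apply: eq_measure_integral => A mA _.
by rewrite /= /trim asboolT.
Qed.

(** * Binary coding of a compact second countable Hausdorff space *)

(** Enumerate the pairs of sets of a countable basis, and keep the disjoint
    ones: two points have disjoint open neighbourhoods, hence disjoint basic ones. *)
Lemma separating_opens (M : topologicalType) : hausdorff_space M ->
  @second_countable M ->
  exists U V : nat -> set M,
    [/\ forall k, open (U k), forall k, open (V k),
        forall k, U k `&` V k = set0 &
        forall y z, y <> z -> exists k, U k y /\ V k z].
Proof.
move=> hM [B /countable_injP[h hinj] [Bo Bb]].
(* W runs through the basis; indices outside of the range of h give the empty
   set. *)
pose W i := [set x | exists2 A, B A /\ h A = i & A x].
have Wo i : open (W i).
  rewrite (_ : W i = \bigcup_(A in [set A | B A /\ h A = i]) A).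
    by apply: bigcup_open => A [/Bo].
  by apply/seteqP; split=> x [A]; exists A.
have WE A : B A -> W (h A) = A.
  move=> BA; apply/seteqP; split=> [x [A' [BA' e]]|x Ax]; last by exists A.
  by rewrite -(hinj A' A) ?inE.
(* Non-disjoint pairs are replaced by a pair of empty sets. *)
pose d k := odflt (0%N, 0%N) (unpickle k) : nat * nat.
pose W' k (i : nat) :=
  if `[< W (d k).1 `&` W (d k).2 = set0 >] then W i else set0.
exists (fun k => W' k (d k).1), (fun k => W' k (d k).2); split.
- by move=> k; rewrite /W'; case: ifP => // _; exact: open0.
- by move=> k; rewrite /W'; case: ifP => // _; exact: open0.
- by move=> k; rewrite /W'; case: ifPn; [move/asboolP|rewrite set0I].
move=> y z /eqP yz.
have := hM; rewrite open_hausdorff.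
move=> /(_ _ _ yz)[[A A'] /= [Ay A'z] [oA oA' /eqP AA']].
have nb x (C : set M) : x \in C -> open C -> exists D, [/\ B D, D x & D `<=` C].
  rewrite inE => Cx oC.
  have /Bb[D [BD Dx] DC] : nbhs x C by exact: open_nbhs_nbhs.
  by exists D.
have [D [BD Dy DA]] := nb _ _ Ay oA; have [D' [BD' D'z DA']] := nb _ _ A'z oA'.
exists (pickle (h D, h D')).
rewrite /W' /d pickleK /= !WE// asboolT//.
by apply/seteqP; split=> // x [/DA Ax /DA' A'x]; rewrite -AA'.
Qed.

(** Points of K_k outside U would have a cluster point in the intersection of
    the K_k, outside U.  With U empty this is Cantor's intersection theorem. *)
Lemma compact_nested (M : topologicalType) (K : nat -> set M) (U : set M) :
  compact [set: M] -> (forall k, closed (K k)) ->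
  (forall k, K k.+1 `<=` K k) -> open U -> \bigcap_k K k `<=` U ->
  exists k, K k `<=` U.
Proof.
move=> cM cK Kdec oU KU; apply: contrapT => /forallNP nK.
have Kmono : {homo K : i j / (i <= j)%N >-> j `<=` i}.
  move=> i j; elim: j => [|j IH]; first by rewrite leqn0 => /eqP ->.
  by rewrite leq_eqVlt => /predU1P[->//|/IH]; exact: subset_trans.
have /choice[x xK] k : exists y, (K k `\` U) y.
  by apply/set0P/eqP => e; apply: (nK k); rewrite -setD_eq0.
have [p [_ px]] := cM (x @ \oo) _ filterT.
have pK k : (K k `\` U) p.
  rewrite setDE; apply: (closedI (cK k) (open_closedC oU)).
  rewrite -setDE => A /px; apply; exists k => // j kj /=.
  by have [? ?] := xK j; split=> //; apply: Kmono kj _ _.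
by case: (pK 0%N) => _; apply; apply: KU => k _; case: (pK k).
Qed.

Section Coding.
Context (M : ptopologicalType) (U V : nat -> set M).

(** A word b_(k-1) :: ... :: b_0 prescribes the first k digits of the coding
    y |-> (y in U_k)_k, its head being the last digit. *)
Fixpoint cell (w : seq bool) : set M :=
  if w is b :: w' then
    cell w' `&` (if b then U (size w') else ~` U (size w'))
  else setT.

(** A closed set containing [cell w], still small enough that the hulls along an
    infinite branch have at most one common point. *)
Fixpoint hull (w : seq bool) : set M :=
  if w is b :: w' then
    hull w' `&` (if b then ~` V (size w') else ~` U (size w'))
  else setT.

Hypothesis oU : forall k, open (U k).
Hypothesis oV : forall k, open (V k).
Hypothesis UV0 : forall k, U k `&` V k = set0.
Hypothesis sepUV : forall y z, y <> z -> exists k, U k y /\ V k z.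

Lemma cell_hull w : cell w `<=` hull w.
Proof.
elim: w => [//|[] w IH] /= x [/IH wx ?]; split=> // Vx.
by have : (U (size w) `&` V (size w)) x by []; rewrite UV0.
Qed.

Lemma hull_closed w : closed (hull w).
Proof.
elim: w => [|b w IH]; first exact: closedT.
by apply: closedI => //; case: b; exact: open_closedC.
Qed.

Lemma cell_measurable w : measurable (cell w : set (borel M)).
Proof.
have mU k : measurable (U k : set (borel M)).
  by apply: sub_sigma_algebra; exact: oU.
elim: w => [|b w IH]; first exact: measurableT.
by apply: measurableI => //; case: b => //; exact: measurableC.
Qed.

Lemma cell_split w : cell w = cell (false :: w) `|` cell (true :: w).
Proof. by rewrite /= -setIUr setUC setUv setIT. Qed.

Lemma cell_disj w : [disjoint cell (false :: w) & cell (true :: w)].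
Proof. by apply/disj_setPS => x [[_ nU] [_ /nU]]. Qed.

Lemma hull_not_separated w k y z : (k < size w)%N -> hull w y -> hull w z ->
  ~ (U k y /\ V k z).
Proof.
elim: w => [//|b w IH] /=; rewrite ltnS leq_eqVlt => /predU1P[->|kw].
  by case: b => -[_ ?] [_ ?] [].
by move=> [? _] [? _]; exact: IH.
Qed.

Hypothesis cM : compact [set: M].

(** The pairs (y, z) not separated by the first k pairs (U_j, V_j) form closed
    sets that decrease to the diagonal of M * M, so for large k they lie in the
    open neighbourhood |g y - g z| < e of the diagonal. *)
Lemma hull_oscillation (R : realType) (g : M -> R) (e : R) :
  continuous g -> 0 < e ->
  exists N, forall w, (N <= size w)%N ->
    forall y z, hull w y -> hull w z -> `|g y - g z| <= e.
Proof.
move=> cg e0.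
pose K k := [set p : M * M | forall j, (j < k)%N -> ~ (U j p.1 /\ V j p.2)].
pose W := [set p : M * M | `|g p.1 - g p.2| < e].
have [|||||N KW] := @compact_nested (M * M)%type K W.
- by rewrite -setXTT; exact: compact_setX.
- move=> k; rewrite (_ : K k =
      \bigcap_(j in `I_k) ~` ((fst @^-1` U j) `&` (snd @^-1` V j))) //.
    apply: closed_bigI => j _; apply: open_closedC; apply: openI.
      by apply: open_comp (oU j) => x _; exact: cvg_fst.
    by apply: open_comp (oV j) => x _; exact: cvg_snd.
- by move=> k p Kp j jk; apply: Kp; exact: ltnW.
- have cd : continuous (fun p : M * M => `|g p.1 - g p.2|).
    move=> p; apply: cvg_norm; apply: cvgB.
      by apply: (@continuous_comp _ _ _ fst g); [exact: cvg_fst|exact: cg].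
    by apply: (@continuous_comp _ _ _ snd g); [exact: cvg_snd|exact: cg].
  by apply: (open_comp _ (@open_lt R e)) => x _; exact: cd.
- move=> [y z] Kyz; rewrite /W /=.
  have [->|/sepUV[k [Uy Vz]]] := pselect (y = z).
    by rewrite subrr normr0.
  by case: (Kyz k.+1 I k).
- exists N => w Nw y z wy wz; apply/ltW/(KW (y, z)) => j jN.
  by apply: (hull_not_separated _ wy wz); exact: leq_trans Nw.
Qed.

End Coding.

(** * Riemann sums over the nodes of a binary tree *)

Section TreeSum.
Context (R : realType).

Fixpoint tree_sum (k : nat) (v : seq bool -> R) (w : seq bool) : R :=
  if k is k'.+1 then tree_sum k' v (false :: w) + tree_sum k' v (true :: w)
  else v w.

(** A Riemann sum estimate: phi is within e of the constant c w on each cell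
    E w of depth k, and these cells partition E [::]. *)
Lemma tree_sum_integral d (T : measurableType d)
    (nu : {measure set T -> \bar R}) (E : seq bool -> set T)
    (phi : T -> R) (c : seq bool -> R) (e : R) (k : nat) :
  (forall w, measurable (E w)) -> (forall w, nu (E w) < +oo)%E ->
  (forall w, E w = E (false :: w) `|` E (true :: w)) ->
  (forall w, [disjoint E (false :: w) & E (true :: w)]) ->
  (forall w, size w = k -> forall x, E w x -> `|phi x - c w| <= e) ->
  nu.-integrable (E [::]) (EFin \o phi) ->
  `|\int[nu]_(x in E [::]) phi x
    - tree_sum k (fun w => c w * fine (nu (E w))) [::]|
  <= e * fine (nu (E [::])).
Proof.
move=> mE fE sE dE cE iE.
suff H j w : (size w + j = k)%N -> nu.-integrable (E w) (EFin \o phi) ->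
  `|\int[nu]_(x in E w) phi x
    - tree_sum j (fun w => c w * fine (nu (E w))) w| <= e * fine (nu (E w)).
  exact: H.
elim: j w => [|j IH] w /=.
  rewrite addn0 => wk iw.
  have icst r : nu.-integrable (E w) (EFin \o cst r).
    by apply: measurable_bounded_integrable => //; exact: bounded_cst.
  have ic : nu.-integrable (E w) (EFin \o (fun=> c w)) := icst (c w).
  have ie : nu.-integrable (E w) (EFin \o (fun=> e)) := icst e.
  rewrite -Rintegral_cst// -RintegralB//.
  have iB : nu.-integrable (E w) (EFin \o (fun x => phi x - c w)).
    by apply: (eq_integrable _ _ _ _ (integrableB _ iw (icst (c w)))).
  apply: le_trans (le_normr_Rintegral _ iB) _ => //.
  rewrite -Rintegral_cst//; apply: le_Rintegral => //.
    exact: (integrable_norm iB).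
  by move=> x; exact: cE.
move=> wk iw; have i0 b : nu.-integrable (E (b :: w)) (EFin \o phi).
  by apply: integrableS iw => //; rewrite (sE w); case: b; [right|left].
rewrite [in X in X - _](sE w) Rintegral_setU//; last by rewrite -sE.
have -> : fine (nu (E w)) =
    fine (nu (E (false :: w))) + fine (nu (E (true :: w))).
  rewrite -fineD ?ge0_fin_numE// -measureU//; first by rewrite -sE.
  exact/disj_set2P.
rewrite opprD addrACA mulrDr; apply: le_trans (ler_normD _ _) _.
by apply: lerD; apply: IH => //=; rewrite addSnnS.
Qed.

Lemma tree_sum_cvg (T : Type) (F : set_system T) {FF : Filter F}
    (q : T -> seq bool -> R) (p : seq bool -> R) k w :
  (forall w, q^~ w @ F --> p w) ->
  (fun t => tree_sum k (q t) w) @ F --> tree_sum k p w.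
Proof.
by move=> qp; elim: k w => [|k IH] w /=; [exact: qp|apply: cvgD; exact: IH].
Qed.

End TreeSum.

(** * A random point with prescribed itinerary *)

Section IntervalTree.
Context (R : realType) (p : seq bool -> R).

Fixpoint left_end (w : seq bool) : R :=
  if w is b :: w' then left_end w' + (if b then p (false :: w') else 0) else 0.

(** The subintervals of [0, 1[ attached to the nodes: that of w has length p w
    and is cut into those of false :: w, on the left, and true :: w. *)
Definition node_itv (w : seq bool) : set (measurableTypeR R) :=
  `[left_end w, left_end w + p w[%classic.

(** The first k turns of x, going right when x is not left of the cut point. *)
Fixpoint branch (x : R) (k : nat) : seq bool :=
  if k is k'.+1 then (left_end (true :: branch x k') <= x) :: branch x k'
  else [::].

Lemma size_branch x k : size (branch x k) = k.
Proof. by elim: k => //= k ->. Qed.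

Hypothesis p0 : forall w, 0 <= p w.
Hypothesis p1 : p [::] = 1.
Hypothesis pS : forall w, p w = p (false :: w) + p (true :: w).

Lemma node_itv_nil : node_itv [::] = `[0, 1[%classic.
Proof. by rewrite /node_itv /= add0r p1. Qed.

Lemma node_itv_split w :
  node_itv w = node_itv (false :: w) `|` node_itv (true :: w).
Proof.
have := p0 (false :: w); have := p0 (true :: w); have := pS w.
rewrite /node_itv /=; set a := left_end w => e h1 h2.
apply/seteqP; split=> x; rewrite /= !in_itv /=.
  move=> /andP[ax xb]; have [?|?] := ltP x (a + p (false :: w)); [left|right];
    by apply/andP; split; lra.
by move=> [] /andP[? ?]; apply/andP; split; lra.
Qed.

Lemma node_itv_disj w : [disjoint node_itv (false :: w) & node_itv (true :: w)].
Proof.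
apply/disj_setPS => x [] /=; rewrite /node_itv /= !in_itv /= addr0.
by move=> /andP[_ h1] /andP[h2 _]; lra.
Qed.

Lemma node_itv_branch x w : node_itv w x -> w = branch x (size w).
Proof.
elim: w => [//|b w IH] bx.
have wx : node_itv w x by rewrite node_itv_split; case: b bx; [right|left].
rewrite [in LHS](IH wx) /= -(IH wx); congr (_ :: _).
move: bx; rewrite /node_itv /= in_itv /=; case: b => /andP[h1 h2].
  by rewrite h1.
by apply/esym/negbTE; rewrite -ltNge; move: h2; rewrite addr0.
Qed.

Lemma branch_node_itv x k : node_itv [::] x -> node_itv (branch x k) x.
Proof.
move=> x01; elim: k => [//|k]; rewrite node_itv_split => -[] h.
  have e : false :: branch x k = branch x k.+1.
    by rewrite [LHS](node_itv_branch h) /= size_branch.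
  by rewrite -e.
have e : true :: branch x k = branch x k.+1.
  by rewrite [LHS](node_itv_branch h) /= size_branch.
by rewrite -e.
Qed.

Lemma lebesgue_node_itv w : lebesgue_measure (node_itv w) = (p w)%:E.
Proof.
rewrite lebesgue_measure_itv /= lte_fin ltrDl lt_neqAle p0 andbT.
case: eqVneq => [<-//|_] /=.
by rewrite -EFinB addrAC subrr add0r.
Qed.

Lemma node_itv_p_gt0 w x : node_itv w x -> 0 < p w.
Proof. by rewrite /node_itv /= in_itv /= => /andP[? ?]; lra. Qed.

Lemma node_itv_sub w : node_itv w `<=` node_itv [::].
Proof.
elim: w => [//|b w IH] x bx; apply: IH.
by rewrite node_itv_split; case: b bx; [right|left].
Qed.

End IntervalTree.

Section UnitInterval.
Context (R : realType).

Let mI : measurable (`[0, 1[%classic : set (measurableTypeR R)).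
Proof. exact: measurable_itv. Qed.

Definition unit_lebesgue : set (measurableTypeR R) -> \bar R :=
  mrestr lebesgue_measure mI.

HB.instance Definition _ := Measure.on unit_lebesgue.

Let unit_lebesgueT : unit_lebesgue setT = 1%E.
Proof.
rewrite /unit_lebesgue /mrestr setTI lebesgue_measure_itv /=.
by rewrite lte_fin ltr01 oppr0 addr0.
Qed.

HB.instance Definition _ :=
  Measure_isProbability.Build _ _ _ unit_lebesgue unit_lebesgueT.

End UnitInterval.

(** The branch followed by a point x of [0, 1[ meets only nodes of positive
    weight, so by compactness the nested closed sets K along it have a common
    point X x, which is unique.  The function X is Borel because, by compactness
    again, X x is in an open set A if and only if some node w of the branch of x
    has K w inside A. *)
Lemma random_point (R : realType) (M : ptopologicalType) (p : seq bool -> R)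
    (K : seq bool -> set M) :
  (forall w, 0 <= p w) -> p [::] = 1 ->
  (forall w, p w = p (false :: w) + p (true :: w)) ->
  compact [set: M] -> (forall w, closed (K w)) ->
  (forall b w, K (b :: w) `<=` K w) ->
  (forall w, 0 < p w -> K w !=set0) ->
  (forall y z, y <> z ->
     exists k, forall w, size w = k -> ~ (K w y /\ K w z)) ->
  exists2 X : measurableTypeR R -> borel M, measurable_fun setT X &
    forall w x, node_itv p w x -> K w (X x).
Proof.
move=> p0 p1 pS cM cK decK neK K1.
have /choice[X XK] (x : measurableTypeR R) : exists z : M,
    if `[< node_itv p [::] x >] then forall k, K (branch p x k) z
    else z = point.
  case: asboolP => [x01|_]; last by exists point.
  apply: contrapT => /forallNP noz.
  have [| | |k] :=
    @compact_nested _ (fun k => K (branch p x k)) set0 cM _ _ open0.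
  - by move=> k; exact: cK.
  - by move=> k /=; exact: decK.
  - by move=> z Kz; apply: (noz z) => k; exact: Kz.
  have [z Kz] := neK _ (node_itv_p_gt0 (branch_node_itv p0 pS k x01)).
  by move/(_ z Kz).
have XKw w x : node_itv p w x -> K w (X x).
  move=> wx; have x01 := node_itv_sub p0 pS wx.
  move: (XK x); rewrite asboolT// [X in K X](node_itv_branch p0 pS wx).
  exact.
exists X => //.
apply: (@measurability _ _ _ (borel M) setT X open) => // _ [A oA <-].
rewrite setTI.
rewrite (_ : X @^-1` A =
    (\bigcup_(w in [set w | K w `<=` A]) node_itv p w) `|`
    (~` node_itv p [::] `&` [set _ | A point])); last first.
  apply/seteqP; split=> [x Ax|x [[w wA /XKw /wA//]|[nx Ap]]].
    have [x01|nx] := pselect (node_itv p [::] x); last first.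
      by right; split=> //=; have := XK x; rewrite asboolF// => <-.
    left; have [||||k kA] := @compact_nested _ (fun k => K (branch p x k)) A cM.
    - by move=> k; exact: cK.
    - by move=> k /=; exact: decK.
    - exact: oA.
    - move=> z Kz; have [->//|/K1[k]] := pselect (z = X x).
      case/(_ (branch p x k) (size_branch p x k)).
      by split; [exact: Kz|apply: XKw; exact: branch_node_itv].
    - by exists (branch p x k) => //; exact: branch_node_itv.
  by have := XK x; rewrite asboolF//= => ->.
have mI w : measurable (node_itv p w) by exact: measurable_itv.
apply: measurableU.
  rewrite bigcup_mkcond; apply: countable_bigcupT_measurable => // w.
  by case: ifP => // _; exact: measurable0.
apply: measurableI; first exact: measurableC.
have [Ap|Ap] := pselect (A point).
  rewrite (_ : [set _ | _] = setT); first exact: measurableT.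
  by apply/seteqP; split.
rewrite (_ : [set _ | _] = set0); first exact: measurable0.
by apply/seteqP; split.
Qed.

(** * Compactness of the space of Borel probability measures *)

Lemma ultra_app (S T : Type) (f : S -> T) (F : set_system S) :
  UltraFilter F -> UltraFilter (f @ F).
Proof.
move=> UF; split=> [|G FG fG]; first exact: fmap_proper_filter.
apply/seteqP; split=> [A GA|]; last exact: fG.
rewrite /fmap /=; have [//|/(fG (~` A)) nA] := in_ultra_setVsetC (f @^-1` A) UF.
have /filter_ex[x []//] : G (A `&` ~` A).
exact: filterI.
Qed.

(** An ultrafilter F on the measures converges to the distribution of the random
    point whose itinerary has the F-limits of the measures of the cells as its
    law. *)
Theorem borel_prob_compact (R : realType) (M : ptopologicalType) :
  compact [set: M] -> hausdorff_space M -> @second_countable M ->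
  compact [set: borel_prob R M].
Proof.
move=> cM hM scM; rewrite compact_ultra => F UF _.
have [U [V [oU oV UV0 sepUV]]] := separating_opens hM scM.
pose q (nu : borel_prob R M) w := fine (nu (cell U w)).
have mcell w : measurable (cell U w : set (borel M)) by exact: cell_measurable.
have q01 nu w : 0 <= q nu w <= 1.
  rewrite fine_ge0//= -lee_fin fineK ?fin_num_measure//.
  exact: probability_le1.
have qS nu w : q nu w = q nu (false :: w) + q nu (true :: w).
  rewrite /q -fineD ?fin_num_measure// -measureU//; first by rewrite -cell_split.
  exact/disj_set2P/cell_disj.
have /choice[p qp] w : exists r : R, q^~ w @ F --> r.
  have := @segment_compact R 0 1; rewrite compact_ultra => /(_ (q^~ w @ F)) [].
  - exact: ultra_app.
  - rewrite /fmap /=; apply: filterS _ filterT => nu _ /=.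
    by rewrite in_itv /=; exact: (q01 nu w).
  - by move=> r [_ ?]; exists r.
have p0 w : 0 <= p w.
  rewrite -(cvg_lim _ (qp w))//; apply: limr_ge; first exact: cvgP (qp w).
  by apply: filterS _ filterT => nu _; case/andP: (q01 nu w).
have pS w : p w = p (false :: w) + p (true :: w).
  have h := cvgD (qp (false :: w)) (qp (true :: w)).
  apply: (@cvg_unique _ (@norm_hausdorff _ R) (q^~ w @ F)); first exact: qp.
  have -> : q^~ w = fun nu => q nu (false :: w) + q nu (true :: w).
    by apply/funext => nu; exact: qS.
  exact: h.
have p1 : p [::] = 1.
  apply: (@cvg_unique _ (@norm_hausdorff _ R) (q^~ [::] @ F)); first exact: qp.
  rewrite (_ : q^~ [::] = cst 1); first exact: cvg_cst.
  by apply/funext => nu; rewrite /q /= probability_setT.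
(* Some measure of the ultrafilter charges the cell of w, which is therefore
   not empty. *)
have hullN w : 0 < p w -> hull U V w !=set0.
  move=> pw; have /filter_ex[nu nuw] : \forall nu \near F, 0 < q nu w.
    exact: cvgr_gt (qp w) _ pw.
  apply/set0P/eqP => h0; move: nuw.
  have := @cell_hull _ _ _ UV0 w; rewrite h0 subset0 /q => ->.
  by rewrite measure0 ltxx.
have [|||X mX XK] := @random_point R M p (hull U V) p0 p1 pS cM _ _ hullN _.
- exact: hull_closed.
- by move=> b w x [].
- move=> y z /sepUV[k yz]; exists k.+1 => w wk [wy wz].
  by apply: (hull_not_separated _ wy wz yz); rewrite wk.
pose Xm : {mfun measurableTypeR R >-> borel M} :=
  HB.pack X (isMeasurableFun.Build _ _ _ _ X mX).
pose mu : borel_prob R M := borel_prob_of (distribution (@unit_lebesgue R) Xm).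
exists mu; split=> //; apply/weakstar_cvgP => g.
have cg : continuous g by exact: cts_fun.
have mg := continuous_borel_measurable cg.
have ig (nu : borel_prob R M) :
    nu.-integrable setT (EFin \o (g : borel M -> R)).
  exact: continuous_integrable.
have iX : (@unit_lebesgue R).-integrable setT (EFin \o (g \o X)).
  apply: measurable_bounded_integrable => //.
  - by rewrite [X in (X < _)%E](@probability_setT _ _ _ (@unit_lebesgue R)) ltry.
  - exact: measurableT_comp.
  - have [D gD] := continuous_compact_norm_le cM cg.
    by apply: (@norm_le_bounded _ _ (g \o X) D) => x; exact: gD.
have muE : \int[mu]_x g x =
    \int[@unit_lebesgue R]_(x in node_itv p [::]) g (X x).
  rewrite Rintegral_borel_prob_of /Rintegral integral_distribution//=; last first.
    exact/measurable_EFinP.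
  congr fine; rewrite node_itv_nil//.
  pose J : set (measurableTypeR R) := `[0, 1[%classic.
  have mJ : measurable J by exact: measurable_itv.
  have J0 : unit_lebesgue (~` J) = 0%E.
    by rewrite /unit_lebesgue /mrestr setICl measure0.
  rewrite (negligible_integral (measurableC mJ) measurableT iX J0).
  by rewrite setTD setCK.
apply/cvgrPdist_le => e e0.
have e3 : 0 < e / 3 by rewrite divr_gt0.
have [N osc] := hull_oscillation oU oV sepUV cM cg e3.
(* The default value [point] only occurs for empty hulls, whose cells are
   null. *)
pose c w := g (xget point (hull U V w)).
have gc w y : size w = N -> hull U V w y -> `|g y - c w| <= e / 3.
  by move=> wN wy; apply: (osc w) => //; [rewrite wN|exact: xgetI wy].
have nuE (nu : borel_prob R M) :
    `|\int[nu]_x g x - tree_sum N (fun w => c w * q nu w) [::]| <= e / 3.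
  have := @tree_sum_integral R _ (borel M) nu (cell U) g c (e / 3) N.
  have -> : fine (nu (cell U [::])) = 1 by rewrite /= probability_setT.
  rewrite mulr1; apply => //.
  - by move=> w; rewrite -ge0_fin_numE// fin_num_measure.
  - exact: cell_split.
  - exact: cell_disj.
  - by move=> w wN x /(cell_hull UV0); exact: gc.
  - exact: ig.
have unitE w : @unit_lebesgue R (node_itv p w) = (p w)%:E.
  rewrite /unit_lebesgue /mrestr setIidl ?lebesgue_node_itv//.
  by rewrite -(node_itv_nil p1); exact: node_itv_sub.
have muS : `|\int[mu]_x g x - tree_sum N (fun w => c w * p w) [::]| <= e / 3.
  have : `|\int[@unit_lebesgue R]_(x in node_itv p [::]) g (X x)
      - tree_sum N (fun w => c w * fine (unit_lebesgue (node_itv p w))) [::]|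
      <= e / 3 * fine (unit_lebesgue (node_itv p [::])).
    apply: tree_sum_integral => //.
    - by move=> w; exact: measurable_itv.
    - by move=> w; rewrite [X in (X < _)%E]unitE ltry.
    - exact: node_itv_split.
    - exact: node_itv_disj.
    - by move=> w wN x /XK; exact: gc.
    - by apply: integrableS iX => //; exact: measurable_itv.
  rewrite -muE unitE p1 mulr1.
  rewrite (_ : (fun w => _ * fine _) = (fun w => c w * p w))//.
  by apply/funext => w; rewrite unitE.
have Scvg : (fun nu => tree_sum N (fun w => c w * q nu w) [::]) @ F -->
    tree_sum N (fun w => c w * p w) [::].
  apply: tree_sum_cvg => w.
  exact: (cvgM (cvg_cst (c w)) (qp w)).
move/cvgrPdist_le : Scvg => /(_ _ e3); apply: filterS => nu Snu.
have := nuE nu; move: muS Snu; rewrite !ler_distl.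
move=> /andP[? ?] /andP[? ?] /andP[? ?].
by apply/andP; split; lra.
Qed.

(** * Empirical measures *)

Section Empirical.
Context (R : realType) (M : ptopologicalType).
Hypothesis cM : compact [set: M].
Variable f : M -> M.

(** The integral with respect to a sum of measures is additive for nonnegative
    functions; adding a constant to g reduces to that case. *)
Lemma Rintegral_empirical (n : nat) (x : M) (g : M -> R) : continuous g ->
  \int[empirical R f n x]_y g y = n.+1%:R^-1 * \sum_(j < n.+1) g (iter j f x).
Proof.
move=> cg; rewrite Rintegral_borel_prob_of.
have mg := continuous_borel_measurable cg.
have [D gleD] := continuous_compact_norm_le cM cg.
have gD y : 0 <= g y + D.
  by move: (gleD y); rewrite ler_norml => /andP[? _]; lra.
have mgD : measurable_fun setT (fun y : borel M => (g y + D)%:E).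
  by apply/measurable_EFinP; exact: measurable_funD.
have ge0E : \int[orbit_average R f n x]_y (g y + D) =
    n.+1%:R^-1 * \sum_(j < n.+1) (g (iter j f x) + D).
  rewrite /Rintegral /orbit_average ge0_integral_mscale//; last first.
    by move=> y _; rewrite lee_fin.
  rewrite ge0_integral_measure_sum//; last by move=> y _; rewrite lee_fin.
  under eq_bigr do rewrite integral_dirac// diracT mul1e.
  by rewrite sumEFin.
have i1 : (orbit_average R f n x).-integrable setT (EFin \o (g : borel M -> R)).
  exact: continuous_integrable.
have i2 : (orbit_average R f n x).-integrable setT
    (EFin \o (cst D : borel M -> R)).
  by apply: continuous_integrable => // y; exact: cvg_cst.
move: ge0E; rewrite RintegralD// Rintegral_cst//.
have -> : fine (orbit_average R f n x setT) = 1.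
  by rewrite [orbit_average _ _ _ _ _]probability_setT.
rewrite mulr1 big_split /= sumr_const card_ord mulrDr -[D *+ _]mulr_natl.
by rewrite mulrA mulVf// mul1r => /addIr.
Qed.

Hypothesis cf : continuous f.

Lemma iter_continuous j : continuous (iter j f).
Proof.
elim: j => [|j IH] x /=; first exact: cvg_id.
by apply: (@continuous_comp _ _ _ (iter j f) f); [exact: IH|exact: cf].
Qed.

Lemma empirical_continuous n : continuous (empirical R f n).
Proof.
move=> x; apply/weakstar_cvgP => g; have cg : continuous g by exact: cts_fun.
suff : (fun y => \int[empirical R f n y]_z g z) @ x -->
    \int[empirical R f n x]_z g z by [].
rewrite Rintegral_empirical//; under eq_fun do rewrite Rintegral_empirical//.
apply: cvgM; first exact: cvg_cst.
apply: (@cvg_big _ _ +%R) => [|j _]; first exact: add_continuous.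
apply: (@continuous_comp _ _ _ (iter j f) g); last exact: cg.
exact: iter_continuous.
Qed.

(** The integrals of g for the n-th and the next empirical measures differ by
    at most 2 sup |g| / (n + 2). *)
Lemma empirical_succ_cvg (x : M) (F : set_system nat) (nu : borel_prob R M) :
  ProperFilter F -> \oo `<=` F ->
  (fun n => empirical R f n x) @ F --> nu ->
  (fun n => empirical R f n.+1 x) @ F --> nu.
Proof.
move=> PF ooF Fnu; apply/weakstar_cvgP => g.
have cg : continuous g by exact: cts_fun.
move/weakstar_cvgP : Fnu => /(_ g) Fg.
have [D gD] := continuous_compact_norm_le cM cg.
pose a n := \int[empirical R f n x]_y g y.
have aE n : a n.+1 = a n + (g (iter n.+1 f x) - a n) * n.+2%:R^-1.
  rewrite /a !Rintegral_empirical// big_ord_recr /=.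
  set s := \sum_(_ < _) _; field.
  have n0 : 0 <= n%:R :> R by exact: ler0n.
  by apply/andP; split; apply: lt0r_neq0; lra.
have aD n : `|a n| <= D.
  rewrite /a Rintegral_empirical// normrM ger0_norm ?invr_ge0// ler_pdivrMl//.
  apply: le_trans (ler_norm_sum _ _ _) _.
  apply: le_trans (ler_sum _ (fun j _ => gD _)) _.
  by rewrite sumr_const card_ord mulr_natl.
suff : (fun n => a n.+1) @ F --> \int[nu]_y g y by [].
under eq_fun do rewrite aE.
rewrite -[\int[nu]_y g y]addr0; apply: cvgD; first exact: Fg.
apply/cvgrPdist_le => e e0; apply: ooF.
have [N _ NP] := nbhs_infty_ger ((D + D) / e); exists N => // n /NP /= Dn.
rewrite sub0r normrN normrM [X in _ * X]ger0_norm// ler_pdivrMr//.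
apply: le_trans (ler_normB _ _) _; apply: le_trans (lerD (gD _) (aD n)) _.
move: Dn; rewrite ler_pdivrMr// => /le_trans; apply.
by rewrite mulrC ler_pM2l// ler_nat; lia.
Qed.

End Empirical.

(** * Limit points of the empirical measures *)

Lemma increasing_ge_id (k : nat -> nat) :
  {homo k : i j / (i < j)%N} -> forall i, (i <= k i)%N.
Proof.
move=> kinc; elim=> [//|i IH]; exact: leq_ltn_trans IH (kinc _ _ (ltnSn i)).
Qed.

(** An ultrafilter plays the role of a subsequence along which A holds and u
    converges. *)
Lemma frequently_ultra_cvg (T : topologicalType) (u : nat -> T) (A : set nat) :
  compact [set: T] -> (forall N, exists2 n, (N <= n)%N & A n) ->
  exists F : set_system nat, exists t : T,
    [/\ UltraFilter F, \oo `<=` F, F A & u @ F --> t].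
Proof.
move=> cT freqA.
pose G := filter_from [set: nat] (fun N => [set n | (N <= n)%N /\ A n]).
have PG : ProperFilter G.
  apply: filter_from_proper => [|N _]; last by have [n ? ?] := freqA N; exists n.
  apply: filter_from_filter; first by exists 0%N.
  move=> i j _ _; exists (maxn i j) => // n [].
  by rewrite geq_max => /andP[? ?] ?; split.
have [F [UF GF]] := ultraFilterLemma PG.
move: (cT); rewrite compact_ultra => /(_ _ (ultra_app u UF) filterT)[t [_ ut]].
exists F, t; split=> //.
- by move=> B [N _ NB]; apply: GF; exists N => // n [Nn _]; exact: NB.
- by apply: GF; exists 0%N => // n [].
Qed.

Section Metric.
Context (R : realType) (M : ptopologicalType).
Local Notation P := (borel_prob R M).
Variable dist : P -> P -> R.
Hypothesis dW : metrizes_weakstar dist.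

Lemma distxx mu : dist mu mu = 0.
Proof. by have [[h _ _] _] := dW; apply/h. Qed.

Lemma distC mu nu : dist mu nu = dist nu mu.
Proof. by have [[_ h _] _] := dW; apply/h. Qed.

Lemma dist_triangle nu mu xi : dist mu xi <= dist mu nu + dist nu xi.
Proof. by have [[_ _ h] _] := dW; apply/h. Qed.

Lemma dist_ge0 mu nu : 0 <= dist mu nu.
Proof.
have := dist_triangle nu mu mu; rewrite distxx (distC nu mu); lra.
Qed.

Lemma dist_gt0 mu nu : mu <> nu -> 0 < dist mu nu.
Proof.
move=> h; rewrite lt_neqAle dist_ge0 andbT eq_sym.
by apply/eqP => e; apply: h; have [[h _ _] _] := dW; apply/h.
Qed.

Lemma dist_ball_open mu (r : R) : open [set nu | dist mu nu < r].
Proof.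
have [_ ->] := dW => nu /= h; exists (r - dist mu nu); first by rewrite subr_gt0.
by move=> xi /= h'; have := dist_triangle nu mu xi; lra.
Qed.

Lemma dist_cvgP (F : set_system P) (mu : P) : Filter F ->
  F --> mu <-> forall e, 0 < e -> \forall nu \near F, dist mu nu < e.
Proof.
move=> FF; split=> [Fmu e e0|h A].
  apply: Fmu; apply: open_nbhs_nbhs; split; first exact: dist_ball_open.
  by rewrite /= distxx.
rewrite /= nbhsE => -[B [oB Bmu] BA]; apply: filterS BA _.
have [_ oP] := dW; have [e e0 eB] := (oP B).1 oB mu Bmu.
by apply: filterS eB _; exact: h.
Qed.

Lemma dist_cvg (F : set_system P) (mu nu : P) {FF : Filter F} :
  F --> nu -> dist mu @ F --> dist mu nu.
Proof.
move=> /dist_cvgP h; apply/cvgrPdist_lt => e /h; apply: filterS => xi nuxi.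
have := dist_triangle nu mu xi; have := dist_triangle xi mu nu.
by rewrite (distC xi nu) ltr_distl => ? ?; apply/andP; split; lra.
Qed.

Lemma weakstar_hausdorff : hausdorff_space P.
Proof.
move=> mu nu clmn; apply: contrapT => /dist_gt0 d0.
have d2 : 0 < dist mu nu / 2 by rewrite divr_gt0.
have nb xi : nbhs (xi : P) [set z | dist xi z < dist mu nu / 2].
  apply: open_nbhs_nbhs; split; first exact: dist_ball_open.
  by rewrite /= distxx.
have [xi [/= h1 h2]] := clmn _ _ (nb mu) (nb nu).
by have := dist_triangle xi mu nu; rewrite (distC xi nu); lra.
Qed.

Section Omega.
Variables (f : M -> M) (x : M).
Local Notation sigma := (fun n => empirical R f n x).

(** Both sides say that mu is a cluster point of the empirical measures; a
    convergent subsequence is extracted as P is metrizable. *)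
Lemma p_omegaP mu : p_omega f x mu <->
  forall e, 0 < e -> forall N, exists2 n, (N <= n)%N & dist mu (sigma n) < e.
Proof.
split=> [[k kinc kmu] e e0 N|freq].
  have /dist_cvgP/(_ e e0)[K _ hK] := kmu.
  exists (k (maxn N K)).
    exact: leq_trans (leq_maxl N K) (increasing_ge_id kinc _).
  by apply: hK => /=; exact: leq_maxr.
have /choice[s sP] (p : nat * nat) : exists n,
    (p.2 < n)%N /\ dist mu (sigma n) < p.1.+1%:R^-1.
  have p0 : 0 < p.1.+1%:R^-1 :> R by rewrite invr_gt0.
  by have [n ? ?] := freq _ p0 p.2.+1; exists n.
pose k := fix k i := if i is j.+1 then s (i, k j) else s (0, 0)%N.
have kS i : (k i < k i.+1)%N by case: (sP (i.+1, k i)).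
have kd i : dist mu (sigma (k i)) < i.+1%:R^-1.
  by case: i => [|i]; [case: (sP (0, 0)%N)|case: (sP (i.+1, k i))].
exists k.
  move=> i j; elim: j => [//|j IH]; rewrite ltnS leq_eqVlt => /predU1P[->//|/IH].
  by move=> h; exact: ltn_trans h (kS j).
apply/dist_cvgP => e e0.
have [N _ NP] := near_infty_natSinv_lt (PosNum e0); exists N => // i /NP /= ie.
exact: lt_trans (kd i) ie.
Qed.

Lemma p_omega_limit (F : set_system nat) (mu : P) :
  ProperFilter F -> \oo `<=` F ->
  sigma @ F --> mu -> p_omega f x mu.
Proof.
move=> PF ooF /dist_cvgP h; apply/p_omegaP => e e0 N.
have FN : F [set n | (N <= n)%N] by apply: ooF; exact: nbhs_infty_ge.
have Fe : F [set n | dist mu (sigma n) < e] := h e e0.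
by have [n [? ?]] := filter_ex (filterI FN Fe); exists n.
Qed.

Hypothesis cP : compact [set: P].

Lemma frequently_p_omega (A : set nat) :
  (forall N, exists2 n, (N <= n)%N & A n) ->
  exists F : set_system nat, exists2 mu,
    [/\ UltraFilter F, \oo `<=` F, F A & sigma @ F --> mu] & p_omega f x mu.
Proof.
move=> /(frequently_ultra_cvg sigma cP)[F [mu [UF ooF FA Fmu]]].
by exists F, mu => //; exact: p_omega_limit Fmu.
Qed.

(** In a compact space, a sequence with a single cluster point converges. *)
Lemma basinP (mu : P) : basin f mu x <-> sigma @ \oo --> mu.
Proof.
split=> [bx|smu].
  apply/dist_cvgP => e e0; apply: contrapT => nev.
  have [|F [nu [UF ooF FA Fnu] nuw]] :=
      @frequently_p_omega [set n | e <= dist mu (sigma n)].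
    move=> N; apply: contrapT => h; apply: nev; exists N => // n Nn /=.
    by rewrite ltNge; apply/negP => ?; apply: h; exists n.
  move: nuw; rewrite bx /= => nuE; move: Fnu; rewrite {}nuE.
  move=> /dist_cvgP/(_ e e0) h.
  have Fe : F [set n | dist mu (sigma n) < e] := h.
  have [n [/= h1 h2]] := filter_ex (filterI FA Fe).
  by move: h1; rewrite leNgt h2.
apply/seteqP; split=> nu /=; last first.
  by move=> ->; apply: p_omega_limit smu.
move=> [k kinc kmu]; apply: (cvg_unique weakstar_hausdorff kmu).
apply: cvg_comp smu => A [N _ NA]; exists N => // i /= Ni; apply: NA => /=.
exact: leq_trans Ni (increasing_ge_id kinc i).
Qed.

(** The margin 1 / (k + 1) keeps the inequality strict in the limit. *)
Lemma eps_basinP mu (e : R) : eps_basin dist f mu e x <->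
  exists k, forall N,
    exists2 n, (N <= n)%N & dist mu (sigma n) < e - k.+1%:R^-1.
Proof.
split.
  move=> /ereal_inf_lt[_ [nu nuw <-]]; rewrite lte_fin => nue.
  have d0 : 0 < (e - dist nu mu) / 2 by rewrite divr_gt0// subr_gt0.
  have [k _ /(_ k (leqnn _))/= hk] := near_infty_natSinv_lt (PosNum d0).
  exists k => N; have [n Nn h] := (p_omegaP nu).1 nuw _ d0 N; exists n => //.
  move: hk h (dist_triangle nu mu (sigma n)); rewrite (distC mu nu) /=.
  by move: (k.+1%:R^-1) => v; lra.
move=> [k /frequently_p_omega[F [nu [UF ooF FA Fnu] nuw]]].
rewrite /eps_basin /=; apply: (@le_lt_trans _ _ (dist nu mu)%:E).
  by apply: ereal_inf_lbound; exists nu.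
rewrite lte_fin; apply: (@le_lt_trans _ _ (e - k.+1%:R^-1)); last first.
  by rewrite ltrBlDr ltrDl invr_gt0.
rewrite distC; have h : (fun n => dist mu (sigma n)) @ F --> dist mu nu.
  exact: dist_cvg Fnu.
rewrite -(cvg_lim _ h)//; apply: limr_le; first exact: cvgP h.
by apply: filterS FA => n /ltW.
Qed.

End Omega.
End Metric.

(** * Observable measures and basins *)

Section Dynamics.
Context (R : realType) (M : ptopologicalType).
Local Notation P := (borel_prob R M).
Variables (dist : P -> P -> R) (f : M -> M).
Hypothesis dW : metrizes_weakstar dist.
Hypothesis cM : compact [set: M].
Hypothesis cP : compact [set: P].
Hypothesis cf : continuous f.

(** The distance from mu to the empirical measures is infinitely often below r,
    and infinitely often above r, hence crosses r infinitely often.  At a limit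
    point xi of the crossing times, it is at most r before the crossing and at
    least r after it, and both sides tend to dist mu xi because consecutive
    empirical measures have the same limits. *)
Lemma p_omega_crossing x (mu nu : P) (r : R) : p_omega f x mu ->
  p_omega f x nu -> 0 < r < dist mu nu ->
  exists2 xi, p_omega f x xi & dist mu xi = r.
Proof.
move=> muw nuw /andP[r0 rd].
pose phi n := dist mu (empirical R f n x).
have freq N : exists2 n, (N <= n)%N & phi n <= r <= phi n.+1.
  apply: contrapT => noc.
  have [n1 Nn1 h1] := (p_omegaP dW f x mu).1 muw _ r0 N.
  have dr : 0 < dist mu nu - r by rewrite subr_gt0.
  have [n2 n12 h2] := (p_omegaP dW f x nu).1 nuw _ dr n1.
  have : phi n2 <= r.
    have [k ->] : exists k, n2 = (n1 + k)%N by exists (n2 - n1)%N; rewrite subnKC.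
    elim: k => [|k IH]; first by rewrite addn0; exact: ltW.
    rewrite addnS leNgt; apply/negP => hk; apply: noc; exists (n1 + k)%N.
      by rewrite (leq_trans Nn1)// leq_addr.
    by rewrite IH ltW.
  have := dist_triangle dW (empirical R f n2 x) mu nu.
  by rewrite (distC dW (empirical R f n2 x) nu) -/(phi n2); lra.
have [F [xi [UF ooF FA Fxi] xiw]] := frequently_p_omega dW f x cP freq.
exists xi => //.
have h1 : phi @ F --> dist mu xi by exact: (dist_cvg dW) Fxi.
have h2 : (fun n => phi n.+1) @ F --> dist mu xi.
  exact: (dist_cvg dW) (empirical_succ_cvg cM _ ooF Fxi).
apply/eqP; rewrite eq_le; apply/andP; split.
  rewrite -(cvg_lim _ h1)//; apply: limr_le; first exact: cvgP h1.
  by apply: filterS FA => n /andP[].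
rewrite -(cvg_lim _ h2)//; apply: limr_ge; first exact: cvgP h2.
by apply: filterS FA => n /andP[].
Qed.

(** Otherwise the distance to mu maps O onto a superset of a nontrivial
    interval, which has positive Lebesgue measure and so is uncountable. *)
Lemma countable_p_omega (O : set P) x : countable O -> p_omega f x `<=` O ->
  exists2 mu, O mu & basin f mu x.
Proof.
move=> cO wO.
have [|F [mu _ muw]] := @frequently_p_omega R M dist dW f x cP setT.
  by move=> N; exists N.
exists mu; first exact: wO.
apply/seteqP; split=> [nu nuw|_ ->//]; apply: contrapT => /= numu.
have d0 : 0 < dist mu nu by apply: (dist_gt0 dW) => e; apply: numu.
have : countable (`]0, dist mu nu[%classic : set R).
  apply: sub_countable cO; apply: card_le_trans (card_image_le (dist mu) O).
  apply: subset_card_le => r; rewrite /= in_itv /= => r0d.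
  have [xi xiw <-] := p_omega_crossing muw nuw r0d.
  by exists xi => //; exact: wO.
move/countable_lebesgue_measure0; rewrite lebesgue_measure_itv /= lte_fin d0.
by rewrite oppr0 adde0 => -[] /eqP; rewrite gt_eqF.
Qed.

Lemma empirical_ball_measurable n (mu : P) (r : R) :
  measurable ([set x | dist mu (empirical R f n x) < r] : set (borel M)).
Proof.
apply: sub_sigma_algebra.
have /continuousP h := @empirical_continuous R M cM f cf n.
exact: h (dist_ball_open dW mu r).
Qed.

Lemma basin_measurable (mu : P) : measurable (basin f mu : set (borel M)).
Proof.
rewrite (_ : basin f mu =
    \bigcap_k \bigcup_N \bigcap_(n in [set n | (N <= n)%N])
    [set x | dist mu (empirical R f n x) < k.+1%:R^-1]).
  apply: bigcapT_measurable => k; apply: bigcupT_measurable => N.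
  apply: bigcap_measurable; first by exists N => /=.
  by move=> n _; exact: empirical_ball_measurable.
apply/seteqP; split=> x.
  move=> /(basinP dW _ _ cP)/(dist_cvgP dW) h k _.
  have [|N _ NP] := h k.+1%:R^-1; first by rewrite invr_gt0.
  by exists N => // n; exact: NP.
move=> h; apply/(basinP dW _ _ cP)/(dist_cvgP dW) => e e0.
have [k _ /(_ k (leqnn _))/= hk] := near_infty_natSinv_lt (PosNum e0).
by have [N _ NP] := h k I; exists N => // n /= /NP /= /lt_trans; apply.
Qed.

Lemma eps_basin_measurable (mu : P) (e : R) :
  measurable (eps_basin dist f mu e : set (borel M)).
Proof.
rewrite (_ : eps_basin dist f mu e =
    \bigcup_k \bigcap_N \bigcup_(n in [set n | (N <= n)%N])
    [set x | dist mu (empirical R f n x) < e - k.+1%:R^-1]).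
  apply: bigcupT_measurable => k; apply: bigcapT_measurable => N.
  by apply: bigcup_measurable => n _; exact: empirical_ball_measurable.
apply/seteqP; split=> x.
  move=> /(eps_basinP dW _ _ cP)[k kP]; exists k => // N _.
  by have [n Nn h] := kP N; exists n.
move=> [k _ kP]; apply/(eps_basinP dW _ _ cP); exists k => N.
by have [n Nn h] := kP N I; exists n.
Qed.

Variable m : P.
Local Notation O := (observable m dist f).

Lemma not_observableP (mu : P) : ~ O mu ->
  exists2 e, 0 < e & m (eps_basin dist f mu e) = 0%E.
Proof.
move=> /existsNP[e /not_implyP[e0 /negP]]; rewrite -leNgt => h.
by exists e => //; apply/eqP; rewrite eq_le h measure_ge0.
Qed.

Lemma eps_basin_near (mu nu : P) (e e' : R) : dist mu nu + e <= e' ->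
  eps_basin dist f mu e `<=` eps_basin dist f nu e'.
Proof.
move=> h x /ereal_inf_lt[_ [xi xiw <-]]; rewrite lte_fin => xie.
apply: (@le_lt_trans _ _ (dist xi nu)%:E).
  by apply: ereal_inf_lbound; exists xi.
by rewrite lte_fin; have := dist_triangle dW mu xi nu; lra.
Qed.

(** O is closed: A_(e/2)(nu) is contained in the null set A_e(mu) as soon as
    dist nu mu <= e / 2. *)
Lemma not_observable_ball (mu : P) : ~ O mu ->
  exists k, forall nu, O nu -> k.+1%:R^-1 <= dist nu mu.
Proof.
move=> /not_observableP[e e0 me].
have e20 : 0 < e / 2 by rewrite divr_gt0.
have [k _ /(_ k (leqnn _))/= ke] := near_infty_natSinv_lt (PosNum e20).
exists k => nu Onu; rewrite leNgt; apply/negP => nuk.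
have := Onu _ e20; rewrite ltNge -[X in (_ <= X)%E]me => /negP; apply.
apply: le_measure; rewrite ?inE; try exact: eps_basin_measurable.
by apply: eps_basin_near; move: ke nuk; move: (k.+1%:R^-1) => v; lra.
Qed.

(** The sets A such that almost every p_omega x avoids K `\` A form a filter
    containing K.  If it were proper, it would have a cluster point mu in K; but
    mu is not observable, so some ball around mu meets p_omega x only for x in
    a null set, and the complement of that ball belongs to the filter. *)
Lemma negligible_p_omega_compact (K : set P) : compact K -> K `&` O = set0 ->
  m.-negligible [set x | p_omega f x `&` K !=set0].
Proof.
move=> cK KO; apply: contrapT => nK.
pose G := [set A : set P |
  m.-negligible [set x | p_omega f x `&` (K `\` A) !=set0]].
have FG : ProperFilter G.
  split.
    by rewrite /G /= setD0.
  split.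
  - rewrite /G /=; apply: negligibleS (negligible_set0 m).
    by move=> x [mu [_ [_]]]; exact.
  - move=> A B GA GB; apply: negligibleS (negligibleU GA GB).
    move=> x [mu [muw [Kmu nAB]]].
    have [Amu|nA] := pselect (A mu); last by left; exists mu.
    by right; exists mu; split=> //; split=> // Bmu; exact: nAB.
  - move=> A B AB; apply: negligibleS => x [mu [muw [Kmu nB]]].
    by exists mu; split=> //; split=> // /AB.
have GK : G K.
  by apply: negligibleS (negligible_set0 m) => x [mu [_ [Kmu]]]; exact.
have [mu [Kmu Gmu]] := cK G FG GK.
have /not_observableP[e e0 me] : ~ O mu.
  by move=> Omu; have : (K `&` O) mu by []; rewrite KO.
have GB : G (~` [set nu | dist mu nu < e]).
  have nE : m.-negligible (eps_basin dist f mu e).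
    by apply/negligibleP => //; exact: eps_basin_measurable.
  apply: negligibleS nE => x [nu [nuw [Knu /contrapT /= h]]].
  apply: (@le_lt_trans _ _ (dist nu mu)%:E); last by rewrite lte_fin (distC dW).
  by apply: ereal_inf_lbound; exists nu.
have nB : nbhs mu [set nu | dist mu nu < e].
  apply: open_nbhs_nbhs; split; first exact: (dist_ball_open dW).
  by rewrite /= (distxx dW).
by have [nu []] := Gmu _ _ GB nB.
Qed.

(** The complement of O is the union of the compact sets of points at distance
    at least 1 / (k + 1) from O. *)
Lemma p_omega_ae_observable : m.-negligible [set x | ~ (p_omega f x `<=` O)].
Proof.
pose K k := [set mu : P | forall nu, O nu -> k.+1%:R^-1 <= dist nu mu].
suff nK : m.-negligible (\bigcup_k [set x | p_omega f x `&` K k !=set0]).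
  apply: negligibleS nK => x.
  move=> /existsNP[mu /not_implyP[muw /not_observable_ball[k kO]]].
  by exists k => //; exists mu.
apply: negligible_bigcup => k; apply: negligible_p_omega_compact.
  apply: (subclosed_compact _ cP) => //.
  rewrite (_ : K k =
      ~` (\bigcup_(nu in O) [set mu | dist nu mu < k.+1%:R^-1])).
    apply: open_closedC; apply: bigcup_open => nu _.
    exact: (dist_ball_open dW).
  apply/seteqP; split=> mu.
    by move=> h [nu /h]; rewrite /= leNgt => /negP.
  by move=> h nu Onu; rewrite leNgt; apply/negP => ?; apply: h; exists nu.
apply/seteqP; split=> // mu [/(_ mu) h /h].
by rewrite (distxx dW) leNgt invr_gt0 ltr0n.
Qed.

Lemma SRB_observable : SRB m f `<=` O.
Proof.
move=> mu; rewrite /SRB /= => mb e e0; apply: lt_le_trans mb _.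
apply: le_measure; rewrite ?inE.
- exact: basin_measurable.
- exact: eps_basin_measurable.
move=> x bx; apply: (@le_lt_trans _ _ (dist mu mu)%:E).
  by apply: ereal_inf_lbound; exists mu => //; rewrite bx.
by rewrite lte_fin (distxx dW).
Qed.

(** Almost every point lies in the basin of some element of O; of these
    countably many basins, those of the measures that are not SRB are null. *)
Lemma SRB_cover : countable O ->
  m.-negligible (~` \bigcup_(mu in SRB m f) basin f mu).
Proof.
move=> cO; have /countable_injP[h hinj] := cO.
(* The null basins, indexed by nat instead of by elements of O. *)
pose G i := [set x |
  exists mu, [/\ O mu, ~ SRB m f mu, h mu = i & basin f mu x]].
suff nG : m.-negligible ([set x | ~ (p_omega f x `<=` O)] `|` \bigcup_i G i).
  apply: negligibleS nG => x nx.
  have [wO|] := pselect (p_omega f x `<=` O); last by left.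
  have [mu Omu bx] := countable_p_omega cO wO.
  right; exists (h mu) => //; exists mu; split=> // smu.
  by apply: nx; exists mu.
apply: negligibleU; first exact: p_omega_ae_observable.
apply: negligible_bigcup => i.
have [[mu [Omu nmu hmu]]|none] :=
  pselect (exists mu, [/\ O mu, ~ SRB m f mu & h mu = i]).
  suff nb : m.-negligible (basin f mu).
    apply: negligibleS nb => x [nu [Onu _ hnu]].
    by rewrite (hinj mu nu) ?inE// hmu hnu.
  apply/negligibleP; first exact: basin_measurable.
  apply/eqP; rewrite eq_le measure_ge0 andbT leNgt.
  by apply/negP.
apply: negligibleS (negligible_set0 m).
by move=> x [nu [? ? ? _]]; apply: none; exists nu.
Qed.

(** O is closed and contains the SRB measures.  Conversely, A_e(mu) is not null
    when mu is observable, so it meets the basin of an SRB measure, whose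
    distance to mu is then less than e. *)
Lemma observable_closure : countable O -> O = closure (SRB m f).
Proof.
move=> cO; apply/seteqP; split=> mu; last first.
  move=> smu; apply: contrapT => /not_observable_ball[k kO].
  have nB : nbhs mu [set nu | dist mu nu < k.+1%:R^-1].
    apply: open_nbhs_nbhs; split; first exact: (dist_ball_open dW).
    by rewrite /= (distxx dW) invr_gt0.
  have [nu [/SRB_observable/kO h]] := smu _ nB.
  by rewrite /= (distC dW) ltNge h.
move=> Omu B; rewrite nbhsE => -[C [oC Cmu] CB].
have [_ oP] := dW; have [e e0 eC] := (oP C).1 oC mu Cmu.
apply: contrapT => nB; have := Omu e e0.
suff -> : m (eps_basin dist f mu e) = 0%E by rewrite ltxx.
apply/negligibleP; first exact: eps_basin_measurable.
apply: negligibleS (SRB_cover cO) => x.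
move=> /ereal_inf_lt[_ [nu nuw <-]] h [xi sxi bx]; apply: nB; exists nu; split.
  by move: nuw; rewrite bx => ->.
by apply/CB/eC; rewrite /= (distC dW); rewrite lte_fin in h.
Qed.

End Dynamics.

(** * Countably many observable measures *)

Local Open Scope card_scope.

Theorem theorem1p7 (R : realType) (n : nat) (M : ptopologicalType)
  (atlas : set (chart R n M)) (m : borel_prob R M)
  (dist : borel_prob R M -> borel_prob R M -> R) (f : M -> M)
  (M_manifold : is_manifold atlas) (M_compact : compact [set: M])
  (m_Lebesgue : is_Lebesgue_on atlas m)
  (dist_weakstar : metrizes_weakstar dist)
  (f_continuous : continuous f)
  (O_countably_infinite : observable m dist f #= [set: nat]) :
  (exists S : set (borel_prob R M),
     [/\ S `<=` SRB m f, S #= [set: nat] &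
         m.-negligible (~` (\bigcup_(mu in S) basin f mu))]) /\
  observable m dist f = closure (SRB m f).
Proof.
have [hM sM _] := M_manifold.
have cP := @borel_prob_compact R M M_compact hM sM.
have cO : countable (observable m dist f).
  by move/card_eqPle : O_countably_infinite => [].
have Ocl := observable_closure dist_weakstar M_compact cP f_continuous cO.
have SO := SRB_observable dist_weakstar M_compact cP f_continuous (m := m).
split=> //; exists (SRB m f); split=> //.
- apply/card_eqPle; split.
    exact: card_le_trans (subset_card_le SO) cO.
  apply/infiniteP => fS.
  have OS : observable m dist f = SRB m f.
    rewrite Ocl; apply/esym/closure_id.
    apply: compact_closed (weakstar_hausdorff dist_weakstar) _.
    exact: finite_compact.
  have : infinite_set (observable m dist f).
    by apply/infiniteP; move/card_eqPle : O_countably_infinite => [].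
  by rewrite OS.
- exact: SRB_cover dist_weakstar M_compact cP f_continuous _ cO.
Qed.
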